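(* For every positive integer $m$, the star $K_{1,m}$ satisfies $$\chi_{pc}(K_{1,m}) = 1 + \lceil m/2 \rceil .$$
   Context: All graphs are finite and simple. Let $k$ be a positive integer. A $k$-assignment $L$ for a graph $G$ assigns to each vertex $v$ a set $L(v)$ of exactly $k$ colors; its palette is $\mathcal{L} = \bigcup_{v \in V(G)} L(v)$, and for $c \in \mathcal{L}$, $\eta(c) = |\{v \in V(G) : c \in L(v)\}|$. A proper $L$-coloring of $G$ is a proper coloring $f$ of $G$ with $f(v) \in L(v)$ for every vertex $v$. It is a proportional $L$-coloring if for every $c \in \mathcal{L}$, $|f^{-1}(c)|$ equals $\lfloor \eta(c)/k \rfloor$ or $\lceil \eta(c)/k \rceil$. $G$ is proportionally $k$-choosable if a proportional $L$-coloring of $G$ exists for every $k$-assignment $L$ for $G$. The proportional choice number $\chi_{pc}(G)$ is the smallest positive integer $k$ such that $G$ is proportionally $k$-choosable. $K_{1,m}$ is the complete bipartite graph with partite sets of sizes $1$ and $m$. *)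

(* Defs.v *)
From mathcomp Require Import all_boot.

Set Implicit Arguments.
Unset Strict Implicit.
Unset Printing Implicit Defensive.

Record sgraph := SGraph {
  vertex :> finType;
  adj : rel vertex;
  adj_sym : symmetric adj;
  adj_irrefl : irreflexive adj
}.

Section CompleteBipartite.

Variables a b : nat.

Definition bip_adj (x y : 'I_a + 'I_b) : bool :=
  match x, y with
  | inl _, inr _ | inr _, inl _ => true
  | _, _ => false
  end.

Fact bip_adj_sym : symmetric bip_adj.
Proof. by case=> i [] j. Qed.

Fact bip_adj_irrefl : irreflexive bip_adj.
Proof. by case. Qed.

Definition complete_bipartite : sgraph := SGraph bip_adj_sym bip_adj_irrefl.

End CompleteBipartite.

(* The ceiling of n / d, for d > 0. *)
Definition ceil_div (n d : nat) : nat := n %/ d + ~~ (d %| n).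

Section ListAssignments.

(* The graph is finite, so every palette is finite, and C may be any finite
   type containing the palette; colors of C outside it are never used. *)
Variables (G : sgraph) (C : finType) (k : nat) (L : G -> {set C}).

Definition assignment : Prop := forall v : G, #|L v| = k.

Definition palette : {set C} := \bigcup_(v : G) L v.

Definition eta (c : C) : nat := #|[set v : G | c \in L v]|.

Definition proper_coloring (f : G -> C) : Prop :=
  forall u v : G, adj u v -> f u <> f v.

Definition proper_list_coloring (f : G -> C) : Prop :=
  proper_coloring f /\ forall v : G, f v \in L v.

Definition proportional_coloring (f : G -> C) : Prop :=
  proper_list_coloring f /\
  forall c : C, c \in palette ->
    #|[set v : G | f v == c]| = eta c %/ k \/
    #|[set v : G | f v == c]| = ceil_div (eta c) k.

End ListAssignments.

Definition proportionally_choosable (G : sgraph) (k : nat) : Prop :=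
  forall (C : finType) (L : G -> {set C}),
    assignment k L -> exists f : G -> C, proportional_coloring k L f.

(* The proportional choice number as a relation: k is the least positive
   integer such that G is proportionally k-choosable. *)
Definition is_proportional_choice_number (G : sgraph) (k : nat) : Prop :=
  [/\ 0 < k,
      proportionally_choosable G k &
      forall j : nat, 0 < j -> proportionally_choosable G j -> k <= j].

(* Main.v *)
(* The lower bound comes from giving all vertices the same list: if
   2 k <= m + 1 then every color must be used at least twice, but the color of
   the center is used only once.
   For the upper bound, 2 k >= m + 2 forces eta < 2 k, so a color must be used
   at least once if eta >= k, and at most once (twice if eta > k) in any case.
   Give the center a color c with eta c <= k if its list has one, and any color
   of its list otherwise.  What remains is a matching of the leaves into slots
   (one slot per color, two if eta > k) that covers a prescribed set of slots.
   Such a matching exists as soon as Hall's condition holds both for the leaves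
   and for the prescribed slots, and both conditions follow by double
   counting. *)
Require Import Defs.
From mathcomp Require Import all_boot zify.

Set Implicit Arguments.
Unset Strict Implicit.
Unset Printing Implicit Defensive.

(** * Hall's theorem and its refinement with prescribed elements *)

Section Hall.

Variables V S : finType.
Implicit Types N : V -> {set S}.

Definition hall N := forall A : {set V}, #|A| <= #|\bigcup_(v in A) N v|.

Definition del N v x := fun w => if w == v then N v :\ x else N w.

(** Only the neighborhood of [v] shrinks, so a set violating the reduced condition contains [v];
    taking [v] out turns the strict inequality into a weak one. *)
Lemma not_hall_del N v x : hall N -> ~ hall (del N v x) ->
  exists2 A : {set V}, v \notin A &
    #|\bigcup_(w in A) N w :|: (N v :\ x)| <= #|A|.
Proof.
move=> hN nH.
have /existsP[A] : [exists A : {set V}, #|\bigcup_(w in A) del N v x w| < #|A|].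
  apply: contraT; rewrite negb_exists => /forallP h; case: nH => A.
  by move: (h A); rewrite -leqNgt.
have [vA ltA|vNA] := boolP (v \in A); last first.
  rewrite (eq_bigr N) ?ltnNge ?hN // => w wA; rewrite /del.
  by case: eqP => // wv; rewrite -wv wA in vNA.
exists (A :\ v); first by rewrite !inE eqxx.
move: ltA; rewrite (cardsD1 v A) vA add1n ltnS; apply: leq_trans.
apply/subset_leq_card/subsetP => s; rewrite inE => /orP[/bigcupP[w]|sN].
  rewrite !inE => /andP[wv wA] sw; apply/bigcupP; exists w => //.
  by rewrite /del (negPf wv).
by apply/bigcupP; exists v; rewrite // /del eqxx.
Qed.

(* Rado's proof of Hall's theorem: if v has two neighbors, one of them can be
   removed, since by submodularity two violating sets would combine into a
   violation of the original condition. *)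
Lemma hall_del N v x y : hall N -> x \in N v -> y \in N v -> x != y ->
  hall (del N v x) \/ hall (del N v y).
Proof.
move=> hN xv yv xy.
have hallP N' : hall N' \/ ~ hall N'.
  have [/forallP h|/forallP h] :=
    boolP [forall A : {set V}, #|A| <= #|\bigcup_(v in A) N' v|].
    by left.
  by right.
have [|nx] := hallP (del N v x); first by left.
have [|ny] := hallP (del N v y); first by right.
have [A vA leA] := not_hall_del hN nx.
have [B vB leB] := not_hall_del hN ny.
exfalso.
set P := _ :|: _ in leA; set Q := _ :|: _ in leB.
(* As [x != y], the union [P :|: Q] regains all of [N v], so Hall applies to [A :|: B] enlarged by
   [v]; that extra vertex yields the contradiction. *)
have hU : #|v |: (A :|: B)| <= #|P :|: Q|.
  apply: leq_trans (hN _) _; apply/subset_leq_card/subsetP => s /bigcupP[w].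
  rewrite !inE => /or3P[/eqP->|wA|wB] sw.
  - by case: eqP => [sx|_] /=; case: eqP => [sy|_];
       rewrite ?sw ?orbT //=; rewrite -sx -sy eqxx in xy.
  - by apply/orP; left; apply/orP; left; apply/bigcupP; exists w.
  - by apply/orP; right; apply/orP; left; apply/bigcupP; exists w.
have hI : #|A :&: B| <= #|P :&: Q|.
  apply: leq_trans (hN _) _; apply/subset_leq_card/subsetP => s /bigcupP[w].
  rewrite !inE => /andP[wA wB] sw.
  by apply/andP; split; apply/orP; left; apply/bigcupP; exists w.
rewrite cardsU1 !inE negb_or vA vB /= in hU.
move: (cardsUI A B) (cardsUI P Q) leA leB hU hI; lia.
Qed.

(** Induction on the total size of the neighborhoods: edges are deleted until every neighborhood is
    a singleton, where Hall's condition on pairs gives injectivity. *)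
Theorem hall_marriage N : hall N ->
  exists2 f : V -> S, injective f & forall v, f v \in N v.
Proof.
have [n] := ubnP (\sum_v #|N v|); elim: n N => // n IHn N; rewrite ltnS => leN hN.
have N_gt0 v : 0 < #|N v|.
  by have := hN [set v]; rewrite cards1 big_set1.
have [/forallP N1|] := boolP [forall v, #|N v| == 1].
  have /fin_all_exists[f fP] : forall v, exists s, N v = [set s].
    by move=> v; apply/cards1P.
  exists f => [u v fuv|v]; last by rewrite fP set11.
  apply/eqP/negPn/negP => uv; have := hN [set u; v].
  by rewrite cards2 uv bigcup_setU !big_set1 !fP fuv setUid cards1.
rewrite negb_forall => /existsP[v Nv1].
have /card_gt1P[x [y [xv yv xy]]] : 1 < #|N v|.
  by rewrite ltn_neqAle eq_sym Nv1 N_gt0.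
have step z : z \in N v -> hall (del N v z) ->
    exists2 f : V -> S, injective f & forall v, f v \in N v.
  move=> zv hz; have [|f fI fP] := IHn _ _ hz.
    apply: leq_trans leN; rewrite (bigD1 v) //= [X in _ < X](bigD1 v) //=.
    rewrite {1}/del eqxx (cardsD1 z (N v)) zv add1n addSn ltnS leq_add2l.
    by apply: leq_sum => w /negPf wv; rewrite /del wv.
  exists f => // w; move: (fP w); rewrite /del.
  by case: eqP => // ->; rewrite inE => /andP[].
by have [/step|/step] := hall_del hN xv yv xy; apply.
Qed.

End Hall.

(* Mendelsohn-Dulmage, reduced to Hall by adding #|S| - #|V| dummy vertices
   that are adjacent exactly to the elements outside M: a matching of the
   enlarged side is then a bijection onto S. *)
Lemma hall_cover (V S : finType) (N : V -> {set S}) (M : {set S}) :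
    hall N ->
    (forall D : {set S}, D \subset M ->
       #|D| <= #|[set v | ~~ [disjoint N v & D]]|) ->
  exists f : V -> S,
    [/\ injective f, forall v, f v \in N v &
        forall s, s \in M -> exists v, f v = s].
Proof.
move=> hN hM.
have leVS : #|V| <= #|S|.
  by rewrite -cardsT (leq_trans (hN _)) // max_card.
pose W := (V + 'I_(#|S| - #|V|))%type.
pose N' (w : W) := if w is inl v then N v else ~: M.
have cardW : #|{: W}| = #|S| by rewrite card_sum card_ord subnKC.
have /hall_marriage[g gI gP] : hall N'.
  move=> A.
  pose B := [set v | inl v \in A].
  have sBA : \bigcup_(v in B) N v \subset \bigcup_(w in A) N' w.
    apply/subsetP => s /bigcupP[v]; rewrite inE => vA sv.
    by apply/bigcupP; exists (inl v).
  have cardA : #|A| = #|B| + #|[set j | inr j \in A]|.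
    by rewrite -!sum1_card big_sumType /=; congr (_ + _); apply: eq_bigl => i;
       rewrite inE.
  have [j0 jA|jA] := pickP [pred j | inr j \in A]; last first.
    rewrite cardA (_ : [set j | _] = set0) ?cards0 ?addn0; last first.
      by apply/setP => j; rewrite !inE; apply: jA.
    exact: leq_trans (hN B) (subset_leq_card sBA).
  set U := \bigcup_(w in A) N' w in sBA *.
  (* A dummy in [A] is adjacent to everything outside [M], so what [A] misses lies in [M], and every
     vertex adjacent to a missed element is outside [B]. *)
  have sMU : ~: U \subset M.
    rewrite -setCS setCK; apply/subsetP => s sM.
    by apply/bigcupP; exists (inr j0).
  have := hM _ sMU.
  have sub : [set v | ~~ [disjoint N v & ~: U]] \subset ~: B.
    apply/subsetP => v; rewrite !inE; apply: contra => vA.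
    rewrite disjoints_subset setCK; apply: subset_trans sBA.
    by apply: bigcup_sup; rewrite inE.
  move/leq_trans => /(_ _ (subset_leq_card sub)).
  have := max_card [set j | inr j \in A].
  rewrite card_ord cardA; move: (cardsC U) (cardsC B) leVS; lia.
exists (g \o inl); split=> [u v /gI[]//|v|s sM]; first exact: (gP (inl v)).
have /codomP[[v|j] sE] : s \in codom g by apply: inj_card_onto; rewrite ?cardW.
  by exists v.
by move: (gP (inr j)); rewrite -sE inE sM.
Qed.

(** * Incidence counting and rounding *)

Lemma double_count (I C : finType) (L : I -> {set C}) (A : {set I}) (D : {set C}) :
  \sum_(d in D) #|[set i in A | d \in L i]| = \sum_(i in A) #|D :&: L i|.
Proof.
under eq_bigr do rewrite -sum1dep_card big_mkcondr.
rewrite exchange_big /=; apply: eq_bigr => i _.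
by rewrite -big_mkcondr sum1dep_card; apply: eq_card => d; rewrite !inE.
Qed.

(** Floor and ceiling are 0 and 1 if [n < k], both 1 if [n = k], and 1 and 2 if [k < n]; the two
    Booleans encode these ranges. *)
Lemma floor_or_ceil n k x : 0 < n -> n < k.*2 ->
  (k <= n) <= x <= 1 + (k < n) -> x = n %/ k \/ x = ceil_div n k.
Proof.
rewrite /ceil_div => n0 n2k; have k0 : 0 < k by lia.
case: (ltngtP k n) => [kn|nk|<-] /= hx.
- have -> : n %/ k = 1 
    by apply/eqP; rewrite eqn_leq -ltnS ltn_divLR // leq_divRL //; lia.
  have -> : (k %| n) = false.
    apply/negP => /dvdnP[q qE]; move: n2k kn; rewrite {}qE.
    by case: q => [|[|q]]; nia.
  by move: hx; case: x => [|[|[|x]]]; [|left|right|].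
- rewrite divn_small // gtnNdvd //.
  by move: hx; case: x => [|[|x]]; [left|right|].
- by rewrite divnn k0; case: x hx => [|[|x]]; [|left|].
Qed.

Lemma card_star_set m (P : pred ('I_1 + 'I_m)) :
  #|[set v | P v]| = P (inl ord0) + #|[set i | P (inr i)]|.
Proof.
rewrite -!sum1dep_card big_sumType /=; congr (_ + _).
by rewrite big_mkcond big_ord1; case: ifP.
Qed.

(** * Upper bound: coloring the leaves once the center has color [c] *)

Section Star.

Variables (m k : nat) (C : finType).
Variable L : complete_bipartite 1 m -> {set C}.
Hypothesis (kL : assignment k L) (m2k : m.+2 <= k.*2).

Let center : complete_bipartite 1 m := inl ord0.
Let leaf (i : 'I_m) : complete_bipartite 1 m := inr i.
Let leaf_deg (A : {set 'I_m}) d := #|[set i in A | d \in L (leaf i)]|.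

Lemma star_eta d : eta L d = (d \in L center) + leaf_deg setT d.
Proof.
rewrite /eta card_star_set; congr (_ + _).
by apply: eq_card => i; rewrite !inE.
Qed.

Lemma leaf_deg_le_eta A d : leaf_deg A d <= eta L d.
Proof.
rewrite star_eta (leq_trans _ (leq_addl _ _)) // subset_leq_card //.
by apply/subsetP => i; rewrite !inE => /andP[].
Qed.

Lemma star_eta_lt d : eta L d < k.*2.
Proof.
have : leaf_deg setT d <= m by rewrite -[X in _ <= X]card_ord max_card.
by rewrite star_eta; move: m2k; case: (_ \in _) => /=; lia.
Qed.

Variable c : C.
Hypothesis (cL : c \in L center).
Hypothesis (c_low : eta L c <= k \/ forall d, d \in L center -> k < eta L d).

(** The Boolean numbers the slots of a color: [false] is the first, [true] the second, open only
    when [eta] exceeds [k]. The color [c] is reserved for the center. *)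
Let slots (i : 'I_m) : {set C * bool} :=
  [set s | [&& s.1 \in L (leaf i), s.1 != c & s.2 ==> (k < eta L s.1)]].
Let required : {set C * bool} :=
  [set s | [&& s.1 != c, ~~ s.2 & k <= eta L s.1]].

(** If [A] had too few slots, counting color incidences on [A] would force [c] onto at least [k] of
    its leaves, impossible when [eta L c <= k]. *)
Lemma hall_slots : hall slots.
Proof.
move=> A; set U := \bigcup_(i in A) _.
pose N := \bigcup_(i in A) L (leaf i) :\ c.
pose P := [set d in N | eta L d <= k]; pose Q := [set d in N | k < eta L d].
have cardU : #|P| + #|Q|.*2 <= #|U|.
  have <- : #|setX N [set false] :|: setX Q [set true]| = #|P| + #|Q|.*2.
    rewrite cardsU (_ : _ :&: _ = set0); last first.
      by apply/setP => -[d []]; rewrite !inE /= ?andbF.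
    rewrite !cardsX !cards1 cards0 !muln1 subn0 -addnn addnA; congr (_ + _).
    rewrite -(cardsID P N); congr (_ + _); apply: eq_card => d.
      by rewrite !inE andbA andbb.
    by rewrite !inE ltnNge; case: ((d != c) && _); rewrite /= ?andbT ?andbF.
  apply/subset_leq_card/subsetP => -[d b]; rewrite !inE /=.
  case/orP=> [/andP[/andP[dc /bigcupP[i iA di]] /eqP bE]|].
    by apply/bigcupP; exists i; rewrite // inE /= di dc bE.
  case/andP=> /andP[/andP[dc /bigcupP[i iA di]] hd] _.
  by apply/bigcupP; exists i; rewrite // inE /= di dc hd implybT.
apply: leq_trans cardU; rewrite leqNgt; apply/negP => ltA.
have Am : #|A| <= m by rewrite -[X in _ <= X]card_ord max_card.
have count : #|A| * k <= leaf_deg A c + (#|P| * k + #|Q| * #|A|).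
  have -> : #|A| * k = \sum_d leaf_deg A d.
    transitivity (\sum_(d in [set: C]) leaf_deg A d); last first.
      by apply: eq_bigl => d; rewrite inE.
    rewrite double_count -sum_nat_const; apply: eq_bigr => i _.
    by rewrite setTI kL.
  rewrite (bigD1 c) //= leq_add2l -!sum_nat_const.
  rewrite (bigID (mem P)) /= leq_add //.
    rewrite big_mkcond [X in _ <= X]big_mkcond; apply: leq_sum => d _.
    rewrite !inE; case: (d != c) => //=; case: ifP => // /andP[_].
    exact/leq_trans/leaf_deg_le_eta.
  rewrite big_mkcond [X in _ <= X]big_mkcond; apply: leq_sum => d _.
  have degA : leaf_deg A d <= #|A|.
    by apply/subset_leq_card/subsetP => i; rewrite inE => /andP[].
  rewrite !inE; case: (d != c) => //=; case: (boolP (d \in _)) => //= [dN|dN].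
    by rewrite -ltnNge; case: (k < _).
  rewrite /leaf_deg eq_card0 // => i; rewrite !inE; apply/negP=> /andP[iA di].
  by case/negP: dN; apply/bigcupP; exists i.
(* Since [#|A| <= m <= 2k - 2], each color of [Q], with two slots but at most [#|A|] incidences,
   leaves at least 2 further incidences to [c]. *)
have degc : k + #|Q|.*2 <= leaf_deg A c by move: Am m2k count ltA; nia.
have [eta_c|high] := c_low.
  have : leaf_deg A c < eta L c.
    rewrite star_eta cL ltnS subset_leq_card //.
    by apply/subsetP => i; rewrite !inE => /andP[].
  by move: eta_c degc; lia.
(* Now fewer than [k] leaves lie outside [A], while each center color is on at least [k] leaves. So
   the [k - 1] center colors other than [c] all lie in [Q], giving [2k - 2 >= m] slots. *)
have kA : k <= #|A|.
  apply: leq_trans (leq_addr _ _) (leq_trans degc _).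
  by apply/subset_leq_card/subsetP => i; rewrite inE => /andP[].
have sQ : L center :\ c \subset Q.
  apply/subsetP => d; rewrite !inE => /andP[dc dL].
  rewrite high // dc andbT /=.
  apply/negPn/negP => dN; have := high d dL; rewrite star_eta dL.
  have : leaf_deg setT d <= #|~: A|.
    apply/subset_leq_card/subsetP => i; rewrite !inE => /= di.
    by apply: contra dN => iA; apply/bigcupP; exists i.
  by move: (cardsC A) kA m2k; rewrite card_ord; lia.
move: (subset_leq_card sQ) (cardsD1 c (L center)); rewrite cL kL.
by move: ltA Am m2k; lia.
Qed.

(** Required slots are first slots, so [D] amounts to a set [E] of colors with [eta] at least [k],
    and leaves outside [A] carry none of them. Hence [#|E| * k] exceeds [#|A| * k] by at most the
    number of center colors in [E], which is below [k] because [c] is not in [E]. *)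
Lemma hall_required (D : {set C * bool}) : D \subset required ->
  #|D| <= #|[set i | ~~ [disjoint slots i & D]]|.
Proof.
move=> /subsetP DR; set A := [set i | _].
pose E := [set s.1 | s in D].
have EP d : d \in E -> [/\ (d, false) \in D, d != c & k <= eta L d].
  case/imsetP => -[d' b] sD ->; have := DR _ sD.
  by rewrite inE /= => /and3P[dc]; case: b sD.
have -> : #|D| = #|E|.
  rewrite card_in_imset // => -[d b] [d' b'] /DR sD /DR sD' /= dd'.
  by move: sD sD'; rewrite !inE /= dd' => /and3P[_ /negPf-> _] /and3P[_ /negPf-> _].
have lower : #|E| * k <= \sum_(d in E) eta L d.
  by rewrite -sum_nat_const; apply: leq_sum => d /EP[].
have upper : \sum_(d in E) eta L d <= #|E :&: L center| + #|A| * k.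
  under eq_bigr do rewrite star_eta.
  rewrite big_split leq_add //=.
    by rewrite -big_mkcondr sum1dep_card subset_leq_card //;
       apply/subsetP => d; rewrite !inE.
  rewrite double_count -sum_nat_const.
  rewrite big_mkcond [X in _ <= X]big_mkcond; apply: leq_sum => i _.
  rewrite in_setT inE; case: ifP => [_|/negbFE dis].
    by rewrite -(kL (leaf i)) subset_leq_card ?subsetIr.
  rewrite leqn0 cards_eq0; apply/eqP/setP => d.
  rewrite !inE; apply/negP => /andP[/EP[dD dc _] di].
  by move/disjointFl: dis => /(_ _ dD); rewrite inE /= di dc.
have Ec : #|E :&: L center| < k.
  rewrite -(kL center) (cardsD1 c (L center)) cL ltnS subset_leq_card //.
  apply/subsetP => d; rewrite !inE => /andP[/EP[_ -> _] ->]; exact: isT.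
by move: (leq_trans lower upper) Ec; nia.
Qed.

Lemma star_coloring_from_center : exists f, proportional_coloring k L f.
Proof.
have [g [gI gP gR]] := hall_cover hall_slots hall_required.
pose f (v : complete_bipartite 1 m) := if v is inr i then (g i).1 else c.
have gc i : (g i).1 != c by have := gP i; rewrite inE => /and3P[].
exists f; split.
  split=> [[u|u] [v|v] //= _|[u|i]] /=.
  - by move=> cE; have := gc v; rewrite -cE eqxx.
  - by move=> cE; have := gc u; rewrite cE eqxx.
  - by rewrite (ord1 u).
  - by have := gP i; rewrite inE => /and3P[].
move=> d /bigcupP[v _ dv].
have eta_gt0 : 0 < eta L d by apply/card_gt0P; exists v; rewrite inE.
apply: floor_or_ceil => //; first exact: star_eta_lt.
rewrite card_star_set /=.
(* Only the center uses [c], and a count of 1 meets both bounds whatever [eta] is. *)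
have [->|dc] := eqVneq d c.
  rewrite eq_card0 => [|i]; last by rewrite !inE (negPf (gc i)).
  by case: (k <= _) (k < _) => [] [].
rewrite add0n.
(* By injectivity of [g], the leaves colored [d] can be counted as slots of [d]. *)
have <- : #|g @: [set i | (g i).1 == d]| = #|[set i | (g i).1 == d]|.
  exact: card_imset.
apply/andP; split.
  case: (leqP k) => // kd; apply/card_gt0P.
  have [|i gE] := gR (d, false); first by rewrite inE /= dc.
  by exists (d, false); rewrite -gE imset_f // inE gE.
have sub : g @: [set i | (g i).1 == d] \subset
    (if k < eta L d then [set (d, false); (d, true)] else [set (d, false)]).
  apply/subsetP => s /imsetP[i]; rewrite inE => /eqP gd ->.
  have := gP i; rewrite inE gd => /and3P[_ _].
  case: (g i) gd => d' b /= ->.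
  by case: ifP => _; case: b => //=; rewrite !inE eqxx ?orbT.
apply: leq_trans (subset_leq_card sub) _.
by case: (k < _); rewrite ?cards1 // cards2; case: (_ != _).
Qed.

End Star.

(** * The two bounds and the exact value *)

Lemma star_choosable m k : m.+2 <= k.*2 ->
  proportionally_choosable (complete_bipartite 1 m) k.
Proof.
move=> m2k C L kL; pose center : complete_bipartite 1 m := inl ord0.
have /card_gt0P[c0 c0L] : 0 < #|L center| by rewrite kL; lia.
have [c /andP[cL ck]|high] :=
    pickP [pred c | (c \in L center) && (eta L c <= k)].
  exact: (star_coloring_from_center kL m2k cL (or_introl ck)).
apply: (star_coloring_from_center kL m2k c0L); right=> d dL.
by have := high d; rewrite /= dL /= leqNgt => /negbFE.
Qed.

Lemma star_not_choosable m k : 0 < k -> k.*2 <= m.+1 ->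
  ~ proportionally_choosable (complete_bipartite 1 m) k.
Proof.
move=> k0 k2m.
case/(_ 'I_k (fun=> setT)) => [v|f [[fproper _] fprop]].
  by rewrite cardsT card_ord.
pose center : complete_bipartite 1 m := inl ord0.
have etaE : eta (fun _ : complete_bipartite 1 m => [set: 'I_k]) (f center) = m.+1.
  rewrite /eta (_ : [set v | _] = setT); last by apply/setP => v; rewrite !inE.
  by rewrite cardsT card_sum !card_ord.
have le2 : 2 <= m.+1 %/ k by rewrite leq_divRL // mul2n.
have card1 : #|[set v | f v == f center]| = 1.
  rewrite card_star_set eqxx eq_card0 // => i; rewrite !inE.
  by apply/eqP; apply: fproper.
have := fprop (f center); rewrite card1 etaE /ceil_div.
case=> [||]; try by move: le2; lia.
by apply/bigcupP; exists center; rewrite ?inE.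
Qed.

Theorem theorem11 (m : nat) (hm : 0 < m) :
  is_proportional_choice_number (complete_bipartite 1 m) (1 + ceil_div m 2).
Proof.
have ceil2 : ceil_div m 2 = uphalf m.
  by rewrite /ceil_div dvdn2 negbK divn2 uphalf_half addnC.
(* [1 + uphalf m] is the least [k] with [m.+2 <= k.*2], and any smaller [j] has [j.*2 <= m.+1], so
   the two bounds meet. *)
rewrite ceil2; split=> // [|j j0 jP]; first by apply: star_choosable; lia.
rewrite leqNgt; apply/negP => lt_j.
by apply: (star_not_choosable j0 _ jP); lia.
Qed.
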